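(* Let $n,k,\ell$ be positive integers, let $p$ be a prime divisor of $n$, let $\Gamma=\mathrm{Cay}(\mathbb{Z}_n,\{x^k,x^{-k},x^\ell,x^{-\ell}\})$ be a connected circulant quartic graph, and let $C$ be an $(a,b)$-regular set in $\Gamma$. Suppose that either $p\nmid k$ and $p\mid\ell$, or $p\mid k$ and $p\nmid\ell$. If one of the following conditions holds: (i) $p=2$ and $b-a\notin\{-4,0\}$; (ii) $p=3$ and $b-a\notin\{-4,-1\}$; (iii) $p>3$ and $b-a\neq-4$; then $$|x^h\langle x^p\rangle\cap C|=\frac{bn}{p(4+b-a)}$$ for every $0\le h\le p-1$.
   Context: $\mathbb{Z}_n=\langle x\rangle$ denotes the cyclic group of order $n$, written multiplicatively. For a finite group $G$ with identity $e$ and an inverse-closed subset $S\subseteq G\setminus\{e\}$, the Cayley graph $\mathrm{Cay}(G,S)$ is the simple graph with vertex set $G$ in which $y$ and $z$ are adjacent if and only if $y^{-1}z\in S$. A circulant quartic graph is a graph $\mathrm{Cay}(\mathbb{Z}_n,\{x^k,x^{-k},x^\ell,x^{-\ell}\})$ where $x^k,x^{-k},x^\ell,x^{-\ell}$ are four distinct non-identity elements. For a graph $\Gamma$ and nonnegative integers $a,b$, a nonempty proper subset $C$ of $V(\Gamma)$ is an $(a,b)$-regular set of $\Gamma$ if every vertex in $C$ has exactly $a$ neighbours in $C$ and every vertex in $V(\Gamma)\setminus C$ has exactly $b$ neighbours in $C$. *)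

(* Defs.v *)
From HB Require Import structures.
From mathcomp Require Import all_boot all_order all_algebra all_fingroup.

Set Implicit Arguments.
Unset Strict Implicit.
Unset Printing Implicit Defensive.

Section Graphs.

Variable T : finType.
Implicit Types (e : rel T) (C : {set T}).

Definition connected_graph e : Prop := forall u v : T, connect e u v.

Definition neighbours_in e C (v : T) : {set T} := [set u in C | e v u].

Definition regular_set e (a b : nat) C : Prop :=
  [/\ C != set0, C \proper [set: T],
      forall v, v \in C -> #|neighbours_in e C v| = a
    & forall v, v \notin C -> #|neighbours_in e C v| = b].

End Graphs.

Section Cayley.

Local Open Scope group_scope.

Variable gT : finGroupType.
Implicit Types (x : gT) (S : {set gT}).

(* Cay S is a simple graph when S is inverse-closed and 1 \notin S. Every
   circulant_connection_set is inverse-closed, and quartic_connection_set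
   excludes 1. *)
Definition Cay S : rel gT := fun y z => y^-1 * z \in S.

Definition circulant_connection_set x (k l : nat) : {set gT} :=
  [set x ^+ k; x ^- k; x ^+ l; x ^- l].

Definition quartic_connection_set x (k l : nat) : bool :=
  uniq [:: 1; x ^+ k; x ^- k; x ^+ l; x ^- l].

End Cayley.

(* Main.v *)
Require Import Defs.
From HB Require Import structures.
From mathcomp Require Import all_boot all_order all_algebra all_fingroup.
From mathcomp Require Import cyclic zify ring.

(** Counting in two ways the edges between a set [A] of vertices and a regular
    set [C] of [Cay S] expresses [a * #|A :&: C| + b * #|A :\: C|] as the sum
    over [s] in [S] of [#|(A :* s) :&: C|].  Let [N h] be the number of points
    of [C] in the coset [x ^+ h *: <[x ^+ p]>], and let [p] divide [l] (the
    other case follows by exchanging [k] and [l]).  Taking this coset for [A],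
    the generators [x ^+ l] and [x ^- l] fix it while [x ^+ k] and [x ^- k]
    shift it to [h + k] and [h - k], so that, with [c = b - a + 2],
<<
      N (h + k) + c * N h + N (h - k) = b * (n / p).
>>
    Along [h, h + k, h + 2k, ...] the deviation
    [u i = (c + 2) * N (h + i * k) - b * (n / p)] is therefore a [p]-periodic
    integer solution of [u (i + 2) + c * u (i + 1) + u i = 0], and the claim is
    that [u] vanishes.

    A nonzero periodic solution would make [- c] one of the numbers
    [2 * cos (2 * pi * j / p)].  For [j = 0] this means [c = - 2]; for the other
    [j] it means [c = 2] if [p = 2] and [c = 1] if [p = 3], and it is impossible
    for [p > 3] since these cosines are then irrational.  The proof for [p > 3]
    is elementary and follows the size of the integer [c]: when [`|c| >= 3] a
    term of maximal absolute value must vanish; when [c = 2] the solution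
    alternates in sign, up to a linear factor, which an odd period forbids; and
    when [c] is [- 1], [0] or [1] every solution has period 12, hence is
    constant because 12 is coprime to [p].  The lemma [periodic_recurrence_eq0]
    is this argument, and [coset_recurrence] the counting identity. *)

Set Implicit Arguments.
Unset Strict Implicit.
Unset Printing Implicit Defensive.

Import Order.TTheory GRing.Theory Num.Theory.

(** * Periodic integer solutions of a second-order recurrence *)

Section Periodic.

Local Open Scope ring_scope.

Definition periodic (T : Type) (q : nat) (u : nat -> T) : Prop :=
  forall i, u (i + q)%N = u i.

Lemma periodicM (T : Type) (q d : nat) (u : nat -> T) :
  periodic q u -> periodic (d * q) u.
Proof.
move=> per i; elim: d => [|d IHd]; first by rewrite mul0n addn0.
by rewrite mulSn addnCA addnC per.
Qed.

(** Bezout: 1 is the difference of a multiple of [q] and a multiple of [r]. *)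
Lemma coprime_periodic1 (T : Type) (q r : nat) (u : nat -> T) :
  (0 < q)%N -> coprime q r -> periodic q u -> periodic r u -> periodic 1 u.
Proof.
move=> q_gt0 /eqP co_qr perq perr i.
have [s t def_s _] := egcdnP r q_gt0.
by rewrite -(periodicM t perr) -addnA [(1 + _)%N]addnC -co_qr -def_s periodicM.
Qed.

Lemma antiperiodic_odd_eq0 (q : nat) (u : nat -> int) :
  odd q -> periodic q u -> (forall i, u i.+1 = - u i) -> forall i, u i = 0.
Proof.
move=> odd_q perq anti i.
have altu d : u (i + d)%N = (- 1) ^+ d * u i.
  elim: d => [|d IHd]; first by rewrite addn0 mul1r.
  by rewrite addnS anti IHd exprS mulN1r mulNr.
by have := altu q; rewrite perq -signr_odd odd_q expr1; lia.
Qed.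

Lemma periodic_max (q : nat) (u : nat -> int) :
  (0 < q)%N -> periodic q u -> exists j, forall i, `|u i| <= `|u j|.
Proof.
move=> q_gt0 perq.
case: (@arg_maxP _ _ _ (Ordinal q_gt0) xpredT (fun i : 'I_q => `|u i|)) => //.
move=> j _ maxj; exists j => i.
rewrite (divn_eq i q) addnC (periodicM _ perq).
exact: maxj (Ordinal (ltn_pmod i q_gt0)) isT.
Qed.

Variables (c : int) (u : nat -> int).
Hypothesis rec_u : forall i, u i.+2 + c * u i.+1 + u i = 0.

Lemma const_recurrence_eq0 :
  c != - 2%:Z -> periodic 1 u -> forall i, u i = 0.
Proof.
move=> cN2 per1 i; have := rec_u i.
rewrite -[i.+2]addn1 -[i.+1]addn1 !per1 => eq0.
have /eqP: (c + 2) * u i = 0 by lia.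
by rewrite mulf_eq0 => /orP[]; lia.
Qed.

(** At a term of maximal absolute value [M] the recurrence gives
    [`|c| * M <= 2 * M]. *)
Lemma large_recurrence_eq0 (q : nat) :
  (0 < q)%N -> periodic q u -> 3 <= `|c| -> forall i, u i = 0.
Proof.
move=> q_gt0 perq c_ge3; have [j maxj] := periodic_max q_gt0 perq.
suff uj0 : `|u j| = 0 by move=> i; have := maxj i; lia.
(* one period further, the maximal term also has a predecessor *)
have := rec_u (j + q.-1); rewrite -addnS prednK // perq => eq0.
have := maxj (j + q.-1)%N; have := maxj (j + q).+1.
have: 3 * `|u j| <= `|c| * `|u j| by rewrite ler_wpM2r.
by rewrite -normrM; lia.
Qed.

(** The characteristic polynomial is [('X + 1)^2], so the sums of consecutive
    terms alternate in sign, and once they vanish so does [u] itself. *)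
Lemma double_recurrence_eq0 (q : nat) :
  odd q -> periodic q u -> c = 2 -> forall i, u i = 0.
Proof.
move=> odd_q perq c2; have sum0 i : u i.+1 + u i = 0.
  apply: (@antiperiodic_odd_eq0 q (fun i => u i.+1 + u i)) => // j.
    by rewrite -addSn !perq.
  by have := rec_u j; rewrite c2; lia.
by apply: antiperiodic_odd_eq0 odd_q perq _ => i; have := sum0 i; lia.
Qed.

(** The roots of ['X^2 + c *: 'X + 1] are roots of unity of order 3, 4 or 6. *)
Lemma small_recurrence_periodic : `|c| <= 1 -> periodic 12 u.
Proof.
move=> c_le1 i; have rec d := rec_u (i + d).
have := (rec 0, rec 1, rec 2, rec 3, rec 4, rec 5)%N.
have := (rec 6, rec 7, rec 8, rec 9, rec 10)%N.
rewrite -!addnS addn0 => [] [[[[r6 r7] r8] r9] r10] [[[[[r0 r1] r2] r3] r4] r5].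
have [c1 | [c1 | c1]]: c = - 1 \/ c = 0 \/ c = 1 by lia.
all: by move: r0 r1 r2 r3 r4 r5 r6 r7 r8 r9 r10; rewrite c1; lia.
Qed.

Lemma periodic_recurrence_eq0 (p : nat) :
  prime p -> periodic p u -> c != - 2%:Z ->
  (p = 2%N -> c != 2) -> (p = 3%N -> c != 1) -> forall i, u i = 0.
Proof.
move=> p_pr perp cN2 c_p2 c_p3.
have [p2 | p_neq2] := eqVneq p 2%N.
  apply: const_recurrence_eq0 => // i; rewrite addn1.
  (* the difference of two consecutive instances of the recurrence *)
  have /eqP: (c - 2) * (u i.+1 - u i) = 0.
    have := rec_u i; have := rec_u i.+1; have := perp i; have := perp i.+1.
    by rewrite p2 !addn2 => -> -> e1 e0; lia.
  by rewrite mulf_eq0 => /orP[]; have := c_p2 p2; lia.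
have [p3 | p_neq3] := eqVneq p 3%N.
  apply: const_recurrence_eq0 => // i; rewrite addn1.
  have /eqP: (c - 1) * (u i.+1 - u i) = 0.
    have := rec_u i; have := rec_u i.+2; have := perp i; have := perp i.+1.
    by rewrite p3 !addn3 => -> -> e1 e0; lia.
  by rewrite mulf_eq0 => /orP[]; have := c_p3 p3; lia.
have p_gt3 : (3 < p)%N by have := prime_gt1 p_pr; lia.
have [c_ge3 | c_lt3] := lerP 3 `|c|.
  exact: large_recurrence_eq0 (prime_gt0 p_pr) perp c_ge3.
have [c2 | c_neq2] := eqVneq c 2.
  apply: double_recurrence_eq0 perp c2.
  by case: (even_prime p_pr) p_neq2 => // ->.
have c_le1 : `|c| <= 1 by lia.
apply: const_recurrence_eq0 => //.
apply: (coprime_periodic1 (prime_gt0 p_pr) _ perp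
          (small_recurrence_periodic c_le1)).
rewrite -[12%N]/(2 ^ 2 * 3)%N coprimeMr.
by rewrite coprimeXr ?prime_coprime ?dvdn_prime2.
Qed.

End Periodic.

(** * Counting edges out of a set of vertices *)

Local Open Scope group_scope.

Lemma regular_set_double_count (gT : finGroupType) (S A C : {set gT})
    (a b : nat) :
  regular_set (Cay S) a b C ->
  (\sum_(s in S) #|(A :* s) :&: C| = a * #|A :&: C| + b * #|A :\: C|)%N.
Proof.
case=> _ _ nbr_in nbr_out.
have translate s : #|(A :* s) :&: C|
                   = (\sum_(v in A) if (v * s)%g \in C then 1 else 0)%N.
  rewrite -big_mkcondr /= sum1dep_card -(card_rcoset _ s).
  apply: eq_card => y; rewrite !inE !mem_rcoset inE.
  by rewrite mulgKV.
have nbrE v : (\sum_(s in S) if (v * s)%g \in C then 1 else 0)%N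
              = #|neighbours_in (Cay S) C v|.
  rewrite -big_mkcondr /= sum1dep_card -(card_lcoset _ v).
  apply: eq_card => y; rewrite !inE !mem_lcoset inE.
  by rewrite mulKVg andbC.
rewrite (eq_bigr _ (fun s _ => translate s)) exchange_big /=.
rewrite (eq_bigr _ (fun v _ => nbrE v)) (big_setID C) /=; congr (_ + _)%N.
  rewrite (eq_bigr (fun=> a)) ?sum_nat_const 1?mulnC // => v /setIP[_].
  exact: nbr_in.
rewrite (eq_bigr (fun=> b)) ?sum_nat_const 1?mulnC // => v /setDP[_].
exact: nbr_out.
Qed.

(** * Regular sets of circulant quartic graphs *)

Lemma circulant_connection_setC (gT : finGroupType) (x : gT) (k l : nat) :
  circulant_connection_set x k l = circulant_connection_set x l k.
Proof.
by rewrite /circulant_connection_set -(setUA _ [set x ^+ l]) setUC setUA.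
Qed.

Lemma quartic_connection_setC (gT : finGroupType) (x : gT) (k l : nat) :
  quartic_connection_set x k l = quartic_connection_set x l k.
Proof.
apply: perm_uniq; rewrite perm_cons.
exact: permEl (perm_catC [:: x ^+ k; x ^- k] [:: x ^+ l; x ^- l]).
Qed.

Lemma big_quartic (gT : finGroupType) (x : gT) (k l : nat) (F : gT -> nat) :
  quartic_connection_set x k l ->
  (\sum_(s in circulant_connection_set x k l) F s
   = F (x ^+ k) + F (x ^- k) + F (x ^+ l) + F (x ^- l))%N.
Proof.
rewrite /quartic_connection_set cons_uniq => /andP[_ uniq_kl].
rewrite -[RHS]addnA -[RHS]addnA.
transitivity (\sum_(s <- [:: x ^+ k; x ^- k; x ^+ l; x ^- l]) F s)%N.
  rewrite (big_uniq _ uniq_kl) /=; apply: eq_bigl => s.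
  by rewrite !inE -!orbA.
by rewrite !big_cons big_nil addn0.
Qed.

Section CosetCounts.

Variables (gT : finGroupType) (x : gT) (p : nat) (C : {set gT}).

Definition power_coset (h : nat) : {set gT} := x ^+ h *: <[x ^+ p]>.

Definition coset_count (h : nat) : nat := #|power_coset h :&: C|.

Lemma power_coset_shift (h d : nat) :
  power_coset h :* x ^+ d = power_coset (h + d).
Proof.
rewrite /power_coset expgD lcosetM -mulgA norm_rlcoset //.
apply: (subsetP (cent_sub _)); apply/centP=> _ /cycleP[i ->].
by rewrite -expgM; apply: commuteX2.
Qed.

Lemma power_coset_periodic (d : nat) :
  p %| d -> periodic d power_coset.
Proof.
move=> /dvdnP[q ->] h; rewrite /power_coset expgD lcosetM lcoset_id //.
by rewrite mulnC expgM mem_cycle.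
Qed.

Lemma card_power_coset (h : nat) :
  p %| #[x] -> #|power_coset h| = (#[x] %/ p)%N.
Proof.
by move=> p_dvd; rewrite card_lcoset -orderE orderXdiv.
Qed.

(** The double count applied to the coset of [x ^+ (h + k)]: translation by
    [x ^- k] and [x ^+ k] gives its two neighbours, and translation by [x ^+ l]
    or [x ^- l], elements of [<[x ^+ p]>], gives the coset back.  Centring at
    [h + k] and moving the subtracted term across keeps everything in [nat]. *)
Lemma coset_recurrence (k l a b h : nat) :
  p %| #[x] -> p %| l -> quartic_connection_set x k l ->
  regular_set (Cay (circulant_connection_set x k l)) a b C ->
  (coset_count (h + k + k) + 2 * coset_count (h + k) + coset_count h
     + b * coset_count (h + k)
   = b * (#[x] %/ p) + a * coset_count (h + k))%N.
Proof.
move=> p_dvd_x p_dvd_l quartic regC.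
have back d : power_coset (h + d) :* x ^- d = power_coset h.
  by rewrite -power_coset_shift rcosetK.
have := regular_set_double_count (power_coset (h + k)) regC.
rewrite big_quartic // back power_coset_shift.
have fix_l : power_coset (h + k) :* x ^+ l = power_coset (h + k).
  by rewrite power_coset_shift power_coset_periodic.
have fixV_l : power_coset (h + k) :* x ^- l = power_coset (h + k).
  by rewrite -{1}fix_l rcosetK.
rewrite fix_l fixV_l -(card_power_coset (h + k) p_dvd_x).
rewrite -(cardsID C (power_coset (h + k))) -/(coset_count _).
rewrite -/(coset_count (h + k)) -/(coset_count h) -/(coset_count (h + k + k)).
by lia.
Qed.

Lemma coset_count_uniform (k l a b h : nat) :
  prime p -> p %| #[x] -> p %| l -> quartic_connection_set x k l ->
  regular_set (Cay (circulant_connection_set x k l)) a b C ->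
  (b%:Z - a%:Z != - 4%:Z)%R ->
  (p = 2%N -> b%:Z - a%:Z != 0)%R ->
  (p = 3%N -> b%:Z - a%:Z != - 1)%R ->
  ((4 + b%:Z - a%:Z) * (coset_count h)%:Z = b%:Z * (#[x] %/ p)%:Z)%R.
Proof.
move=> p_pr p_dvd_x p_dvd_l quartic regC ba_neq ba_p2 ba_p3.
pose c := (b%:Z - a%:Z + 2)%R.
pose N i := (coset_count (h + i * k)%N)%:Z%R.
(* the factor [c + 2] clears the denominator of the constant solution *)
pose u i := ((c + 2) * N i - b%:Z * (#[x] %/ p)%:Z)%R.
suff /(_ 0%N) : forall i, u i = 0%R.
  by rewrite /u /N /c mul0n addn0; lia.
apply: (@periodic_recurrence_eq0 c u) p_pr _ _ _ _ => [i | i | | p2 | p3].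
- have recN : (N i.+2 + c * N i.+1 + N i = b%:Z * (#[x] %/ p)%:Z)%R.
    have := coset_recurrence (h + i * k) p_dvd_x p_dvd_l quartic regC.
    have -> : (h + i * k + k = h + i.+1 * k)%N by lia.
    have -> : (h + i.+1 * k + k = h + i.+2 * k)%N by lia.
    by rewrite /N /c; lia.
  by rewrite /u -recN; ring.
- rewrite /u /N /coset_count mulnDl addnA power_coset_periodic //.
  exact: dvdn_mulr.
- by rewrite /c; lia.
- by have := ba_p2 p2; rewrite /c; lia.
- by have := ba_p3 p3; rewrite /c; lia.
Qed.

End CosetCounts.

Theorem corollary2p10 (gT : finGroupType) (x : gT) (n k l p a b : nat)
    (C : {set gT})
    (n_gt0 : (0 < n)%N) (k_gt0 : (0 < k)%N) (l_gt0 : (0 < l)%N)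
    (gen_x : [set: gT] = <[x]>%g) (ord_x : #|gT| = n)
    (p_prime : prime p) (p_dvd_n : (p %| n)%N)
    (quartic : quartic_connection_set x k l)
    (conn : connected_graph (Cay (circulant_connection_set x k l)))
    (regC : regular_set (Cay (circulant_connection_set x k l)) a b C)
    (div_kl : (~~ (p %| k)%N /\ (p %| l)%N) \/ ((p %| k)%N /\ ~~ (p %| l)%N))
    (cond : [\/ p = 2%N /\ (b%:Z - a%:Z)%R \notin [:: (- 4)%R; 0%R],
                p = 3%N /\ (b%:Z - a%:Z)%R \notin [:: (- 4)%R; (- 1)%R]
              | (3 < p)%N /\ (b%:Z - a%:Z)%R <> (- 4)%R]) :
  forall h : nat, (h <= p - 1)%N ->
    (#|((x ^+ h)%g *: <[(x ^+ p)%g]>%g)%g :&: C|%:R : rat)%R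
    = ((b%:R * n%:R) / (p%:R * (4%:R + b%:R - a%:R)))%R.
Proof.
move=> h _.
have n_ordx : n = #[x] by rewrite -ord_x -cardsT gen_x.
have p_dvd_x : p %| #[x] by rewrite -n_ordx.
have [ba_neq ba_p2 ba_p3] : [/\ (b%:Z - a%:Z != - 4%:Z)%R,
    (p = 2%N -> b%:Z - a%:Z != 0)%R & (p = 3%N -> b%:Z - a%:Z != - 1)%R].
  by case: cond => -[p_val]; rewrite ?inE => ba; split; lia.
have countE :
    ((4 + b%:Z - a%:Z) * (coset_count x p C h)%:Z = b%:Z * (#[x] %/ p)%:Z)%R.
  case: div_kl => [[_ p_dvd_l] | [p_dvd_k _]].
    exact: (@coset_count_uniform _ x p C k l).
  apply: (@coset_count_uniform _ x p C l k) => //.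
    by rewrite quartic_connection_setC.
  by rewrite circulant_connection_setC.
have p_neq0 : (p%:R != 0 :> rat)%R.
  by rewrite pnatr_eq0; have := prime_gt0 p_prime; lia.
have ba4_neq0 : (4%:R + b%:R - a%:R != 0 :> rat)%R.
  have -> : (4%:R + b%:R - a%:R = (4 + b%:Z - a%:Z)%:~R :> rat)%R.
    by rewrite rmorphB rmorphD.
  by rewrite intr_eq0; lia.
have countQ : ((4%:R + b%:R - a%:R) * (coset_count x p C h)%:R
               = b%:R * (#[x] %/ p)%:R :> rat)%R.
  have := congr1 (fun z : int => z%:~R : rat)%R countE.
  by rewrite !rmorphM rmorphB rmorphD.
rewrite n_ordx -(divnK p_dvd_x) natrM -/(coset_count x p C h).
by apply: (mulfI ba4_neq0); rewrite countQ; field; rewrite p_neq0 ba4_neq0.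
Qed.
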